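(* Let $(E, \|\cdot\|_E, \tau)$ be a truncated normed Riesz space with norm completion $\overline{E}$. Then $\tau$ extends uniquely to a truncation $\overline{\tau}$ on $\overline{E}$ with $$\sup\{\|\overline{\tau}(f)\| : f \in \overline{E}^{+}\} = 1.$$ If moreover $\tau$ is not unital and $\|\cdot\|_E$ is additive on disjoint positive elements, then $\overline{E}$ is an $AL$-space, the truncation $\overline{\tau}$ is unital, and its truncation unit lies in $\overline{E} \setminus E$.
   Context: All Riesz spaces are real. A truncation on a Riesz space $E$ is a map $\tau : E^{+} \to E^{+}$ such that $\tau(f) \wedge g = f \wedge \tau(g)$ for all $f, g \in E^{+}$. It is unital if there is $u \in E^{+}$ with $\tau(f) = u \wedge f$ for all $f \in E^{+}$; such $u$ is unique and is called the truncation unit. A truncated normed Riesz space is a triple $(E, \|\cdot\|_E, \tau)$ where $E$ is a Riesz space, $\|\cdot\|_E$ is a lattice norm on $E$, and $\tau$ is a truncation on $E$ such that $\tau(f)=0$ implies $f=0$, and $\sup\{\|\tau(f)\|_E : f \in E^{+}\} = 1$. The norm completion $\overline{E}$ is a Banach lattice containing $E$ as a norm dense Riesz subspace. A lattice norm is additive on disjoint positive elements if $\|x+y\| = \|x\| + \|y\|$ whenever $x \wedge y = 0$. An $AL$-space is a Banach lattice whose norm is additive on disjoint positive elements. *)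

(* Defs.v *)
From HB Require Import structures.
From mathcomp Require Import all_boot all_order all_algebra.
From mathcomp Require Import all_classical all_reals all_analysis.

Set Implicit Arguments.
Unset Strict Implicit.
Unset Printing Implicit Defensive.

Import Order.TTheory GRing.Theory Num.Theory.
Import numFieldNormedType.Exports.

Local Open Scope classical_set_scope.
Local Open Scope ring_scope.

(* Hierarchy Builder rejects a new join of latticeType (or porderType) with
   normedModType, because the existing number structures inherit from both.
   The lattice order of a Riesz space is therefore carried by the mixin. *)
HB.mixin Record Lmodule_isRiesz (R : realType) V of GRing.Lmodule R V := {
  rle : rel V ;
  rmeet : V -> V -> V ;
  rjoin : V -> V -> V ;
  rle_refl : reflexive rle ;
  rle_anti : antisymmetric rle ;
  rle_trans : transitive rle ;
  rmeetP : forall x y z, rle x (rmeet y z) = rle x y && rle x z ;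
  rjoinP : forall x y z, rle (rjoin x y) z = rle x z && rle y z ;
  rleD2r : forall z x y : V, rle x y -> rle (x + z) (y + z) ;
  rscale_ge0 : forall (a : R) (x : V), 0 <= a -> rle 0 x -> rle 0 (a *: x)
}.

#[short(type="rieszType")]
HB.structure Definition Riesz (R : realType) :=
  {V of GRing.Lmodule R V & Lmodule_isRiesz R V}.

Notation "x <=r y" := (rle x y) (at level 70, y at next level) : ring_scope.

(* A copy of the carrier, on which the library's lattice notions are available:
   <= , Order.meet and Order.join on it are rle, rmeet and rjoin. *)
Definition lattice_of (R : realType) (E : rieszType R) : Type := E.

Fact riesz_display : Order.disp_t. Proof. exact: Order.Disp tt tt. Qed.

Section LatticeOf.
Variables (R : realType) (E : rieszType R).
HB.instance Definition _ := Choice.copy (lattice_of E) E.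
HB.instance Definition _ := Order.Le_isPOrder.Build riesz_display
  (lattice_of E) (@rle_refl R E) (@rle_anti R E) (@rle_trans R E).
HB.instance Definition _ := Order.POrder_MeetJoin_isLattice.Build riesz_display
  (lattice_of E) (@rmeetP R E) (@rjoinP R E).
End LatticeOf.

(* [`|x|] is the norm of x; the lattice modulus is written rabs x. *)
Definition rabs (R : realType) (E : rieszType R) (x : E) : E := rjoin x (- x).

HB.mixin Record NormedModule_Riesz_isNormedRiesz (R : realType) V
    of NormedModule R V & Riesz R V := {
  lattice_norm : forall x y : V, rabs x <=r rabs y -> `|x| <= `|y|
}.

#[short(type="normedRieszType")]
HB.structure Definition NormedRiesz (R : realType) :=
  {V of NormedModule R V & Riesz R V & NormedModule_Riesz_isNormedRiesz R V}.

#[short(type="banachLatticeType")]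
HB.structure Definition BanachLattice (R : realType) :=
  {V of NormedRiesz R V & Complete V}.

Definition pos_cone (R : realType) (E : rieszType R) := {x : E | 0 <=r x}.

Section Truncations.
Variables (R : realType) (E : rieszType R).
Implicit Types (tau : pos_cone E -> pos_cone E) (u : pos_cone E).

Definition is_truncation tau : Prop :=
  forall f g : pos_cone E,
    rmeet (val (tau f)) (val g) = rmeet (val f) (val (tau g)).

Definition is_truncation_unit tau u : Prop :=
  forall f : pos_cone E, val (tau f) = rmeet (val u) (val f).

Definition unital tau : Prop := exists u, is_truncation_unit tau u.

End Truncations.

Section Norms.
Variables (R : realType) (E : normedRieszType R).

(* Taken in the extended reals, so that it is a genuine supremum even when the
   values are unbounded. *)
Definition truncation_sup_norm (tau : pos_cone E -> pos_cone E) : \bar R :=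
  ereal_sup [set (`|val (tau f)|)%:E | f in [set: pos_cone E]].

Definition additive_on_disjoint : Prop :=
  forall x y : E, 0 <=r x -> 0 <=r y -> rmeet x y = 0 ->
    `|x + y| = `|x| + `|y|.

Record is_truncated_normed_riesz (tau : pos_cone E -> pos_cone E) : Prop := {
  tnr_truncation : is_truncation tau ;
  tnr_eq0 : forall f : pos_cone E, val (tau f) = 0 -> val f = 0 ;
  tnr_sup : truncation_sup_norm tau = 1%:E
}.

End Norms.

Arguments additive_on_disjoint {R} E.

Definition is_AL_space (R : realType) (F : banachLatticeType R) : Prop :=
  additive_on_disjoint F.

(* F is a norm completion of E, the inclusion of E in F being iota. *)
Record is_norm_completion (R : realType) (E : normedRieszType R)
    (F : banachLatticeType R) (iota : {linear E -> F}) : Prop := {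
  completion_meet : {morph iota : x y / rmeet x y >-> rmeet x y} ;
  completion_join : {morph iota : x y / rjoin x y >-> rjoin x y} ;
  completion_norm : forall x : E, `|iota x| = `|x| ;
  completion_dense : dense (range iota)
}.

Definition extends_truncation (R : realType) (E F : rieszType R)
    (iota : E -> F) (tau : pos_cone E -> pos_cone E)
    (taubar : pos_cone F -> pos_cone F) : Prop :=
  forall (f : pos_cone E) (g : pos_cone F),
    val g = iota (val f) -> val (taubar g) = iota (val (tau f)).

(* Main.v *)
Require Import Defs.
From HB Require Import structures.
From mathcomp Require Import all_boot all_order all_algebra.
From mathcomp Require Import all_classical all_reals all_analysis.
From mathcomp Require Import lra.

Set Implicit Arguments.
Unset Strict Implicit.
Unset Printing Implicit Defensive.

Import Order.TTheory GRing.Theory Num.Theory.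
Import numFieldNormedType.Exports.

Local Open Scope classical_set_scope.
Local Open Scope ring_scope.

(** Why the theorem is true.

    Everything rests on one identity, [truncation_meet]: if [f <= h] then
    [tau f] is the meet of [f] and [tau h].  So a truncation is, below any
    given [h], the meet with the fixed element [tau h].  Meeting with a fixed
    element is a contraction, hence every truncation on a normed Riesz space
    is 1-Lipschitz ([truncation_lip]).

    Extension and uniqueness.  Since [iota] is isometric and the positive cone
    of [E] is dense in that of [F] ([pos_dense]), a 1-Lipschitz map extends to
    the completion.  The value at [z] is characterised as the only [y] with
    [|iota (tau g) - y| <= |z - iota g|] for all positive [g] in [E]
    ([extension_value]).  Any truncation of [F] extending [tau] is 1-Lipschitz
    and therefore takes this value, which gives uniqueness; the truncation
    identity and the bound on the norms pass to the limit because meets and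
    norms are continuous.

    Additivity.  If [x] and [y] are disjoint in [F], approximate them by
    positive [a] and [b] in [E]; then [a - a /\ b] and [b - a /\ b] are
    disjoint and still approximate [x] and [y] ([completion_AL]).

    The unit.  For a norm additive on disjoint elements, the net of the
    elements [tau f], directed by the order of the [f], is Cauchy
    ([truncation_gap]), and its limit [u] is a unit: [tau f] is the meet of
    [f] and [tau h] for all [h >= f], hence in the limit the meet of [f] and
    [u] ([truncation_unital]).  To see that the net is Cauchy, take [f] with
    [|tau f|] close to 1, a large constant [C], and [g = C f].  For
    [h >= g] put [w = tau h].  The increment [tau h - tau g] is the positive
    part of [w - C f]; it is disjoint from the meet [q] of [w] with the
    positive part of [C f - w], and both lie below [w], so their norms add up
    to at most 1.  But [q] is at least [tau f - C^-1 w], so its norm is close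
    to 1 as well, and the increment is small.

    Finally a unit of the extension that lies in [E] is a unit of [tau], as
    [iota] is injective and preserves meets ([extension_unit_notin]). *)

Lemma ler_scaled_eps (R : realFieldType) (K a b : R) :
  (forall e : R, 0 < e -> a <= b + K * e) -> a <= b.
Proof.
move=> H; apply/ler_addgt0Pr => e e0.
have K1 : 0 < `|K| + 1 by rewrite ltr_wpDl.
apply: le_trans (H (e / (`|K| + 1)) (divr_gt0 e0 K1)) _.
rewrite lerD2l mulrA ler_pdivrMr // mulrC ler_pM2l //.
by rewrite (le_trans (ler_norm K)) // lerDl.
Qed.

(** * Riesz spaces *)

Section RieszTheory.
Variables (R : realType) (E : rieszType R).
Implicit Types x y z w a b c : E.

Lemma rmeetC x y : rmeet x y = rmeet y x.
Proof. exact: (@meetC _ (lattice_of E)). Qed.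

Lemma rmeetA x y z : rmeet x (rmeet y z) = rmeet (rmeet x y) z.
Proof. exact: (@meetA _ (lattice_of E)). Qed.

Lemma rmeet_lel x y : rmeet x y <=r x.
Proof. exact: (@leIl _ (lattice_of E)). Qed.

Lemma rmeet_ler x y : rmeet x y <=r y.
Proof. exact: (@leIr _ (lattice_of E)). Qed.

Lemma rmeet_idPl x y : reflect (rmeet x y = x) (x <=r y).
Proof. exact: (@meet_idPl _ (lattice_of E)). Qed.

Lemma rle_trans' y x z : x <=r y -> y <=r z -> x <=r z.
Proof. exact: rle_trans. Qed.

Lemma rle_eq x y : x <=r y -> y <=r x -> x = y.
Proof. by move=> xy yx; apply: rle_anti; rewrite xy. Qed.

Lemma rleBDr x y z : (x - y <=r z) = (x <=r z + y).
Proof.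
apply/idP/idP => h; first by rewrite -(subrK y x); apply: rleD2r.
by rewrite -(addrK y z); apply: rleD2r.
Qed.

Lemma rsub_ge0 x y : (0 <=r y - x) = (x <=r y).
Proof. by rewrite -{2}(subrK x y) -[RHS]rleBDr subrr. Qed.

Lemma rleD x y z w : x <=r y -> z <=r w -> x + z <=r y + w.
Proof.
move=> xy zw; apply: rle_trans' (rleD2r z _ _ xy) _.
by rewrite ![y + _]addrC; apply: rleD2r.
Qed.

Lemma radd_ge0 x y : 0 <=r x -> 0 <=r y -> 0 <=r x + y.
Proof. by move=> x0 y0; rewrite -[0](addr0 0); apply: rleD. Qed.

Lemma rle_addr x y : 0 <=r y -> x <=r x + y.
Proof.
by move=> y0; rewrite -{1}(addr0 x); apply: rleD => //; apply: rle_refl.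
Qed.

Lemma rle_addl x y : 0 <=r y -> x <=r y + x.
Proof. by rewrite addrC; apply: rle_addr. Qed.

Lemma rle_scale (k : R) x : 1 <= k -> 0 <=r x -> x <=r k *: x.
Proof.
move=> k1 x0; rewrite -rsub_ge0 -{2}(scale1r x) -scalerBl.
by apply: rscale_ge0; rewrite // subr_ge0.
Qed.

Lemma rle_scale_mono (k : R) x y : 0 <= k -> x <=r y -> k *: x <=r k *: y.
Proof.
by move=> k0 xy; rewrite -rsub_ge0 -scalerBr rscale_ge0 // rsub_ge0.
Qed.

Lemma rmeet_ge0 x y : 0 <=r x -> 0 <=r y -> 0 <=r rmeet x y.
Proof. by move=> x0 y0; rewrite rmeetP x0. Qed.

Lemma rmeetDr x y z : rmeet x y + z = rmeet (x + z) (y + z).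
Proof.
apply: rle_eq; first by rewrite rmeetP !rleD2r ?rmeet_lel ?rmeet_ler.
by rewrite -rleBDr rmeetP !rleBDr rmeet_lel rmeet_ler.
Qed.

(** [x - x /\ y] is the positive part of [x - y], and [y - x /\ y] its
    negative part. *)
Lemma rmeetB_disjoint x y : rmeet (x - rmeet x y) (y - rmeet x y) = 0.
Proof. by rewrite -rmeetDr subrr. Qed.

(** Two disjoint elements below [w] have their supremum, which is their sum,
    below [w]. *)
Lemma rdisjointD_le x y w :
  rmeet x y = 0 -> x <=r w -> y <=r w -> x + y <=r w.
Proof.
move=> xy0 xw yw; rewrite -[y]opprK rleBDr.
have -> : w - y = rmeet (x + (w - y)) w.
  by rewrite -{3}(subrKC y w) -rmeetDr xy0 add0r.
by rewrite rmeetP xw rle_addr // rsub_ge0.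
Qed.

Lemma rabs_le x z : (rabs x <=r z) = (x <=r z) && (- x <=r z).
Proof. exact: rjoinP. Qed.

Lemma rle_rabs x : x <=r rabs x.
Proof. by have := rle_refl (rabs x); rewrite {1}rabs_le => /andP[]. Qed.

Lemma rle_rabsN x : - x <=r rabs x.
Proof. by have := rle_refl (rabs x); rewrite {1}rabs_le => /andP[]. Qed.

Lemma rabs_ge0 x : 0 <=r rabs x.
Proof.
have h : 0 <=r rabs x + rabs x.
  by rewrite -(subrr x); apply: rleD; [apply: rle_rabs|apply: rle_rabsN].
have -> : rabs x = 2^-1 *: (rabs x + rabs x).
  rewrite -mulr2n -[X in _ *: X]scaler_nat scalerA.
  by rewrite mulVf ?scale1r // pnatr_eq0.
by apply: rscale_ge0; rewrite // invr_ge0.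
Qed.

Lemma rabs_pos x : 0 <=r x -> rabs x = x.
Proof.
move=> x0; apply: rle_eq; last exact: rle_rabs.
rewrite rabs_le rle_refl /=; apply: (rle_trans' _ x0).
by rewrite -rsub_ge0 sub0r opprK.
Qed.

(** The meet of [a] and [b] is at most [c + |a - c|] and at most
    [b + |a - c|], so it exceeds that of [c] and [b] by at most [|a - c|];
    exchanging [a] and [c] gives the other bound. *)
Lemma rmeet_contract a c b : rabs (rmeet a b - rmeet c b) <=r rabs (a - c).
Proof.
have half a' c' : a' - c' <=r rabs (a - c) ->
    rmeet a' b - rmeet c' b <=r rabs (a - c).
  move=> h; rewrite rleBDr addrC rmeetDr rmeetP; apply/andP; split.
    by apply: rle_trans' (rmeet_lel _ _) _; rewrite addrC -rleBDr.
  by apply: rle_trans' (rmeet_ler _ _) _; apply/rle_addr/rabs_ge0.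
rewrite rabs_le half ?rle_rabs //= opprB half // -opprB; exact: rle_rabsN.
Qed.

End RieszTheory.

(** * Truncations *)

Section Truncation.
Variables (R : realType) (E : rieszType R).
Variable tau : pos_cone E -> pos_cone E.
Hypothesis tauP : is_truncation tau.
Implicit Types f g h : pos_cone E.

(** Testing the truncation identity against [tau f] itself gives
    [tau f = f /\ tau (tau f)]. *)
Lemma truncation_le f : val (tau f) <=r val f.
Proof.
have := tauP f (tau f); rewrite (rmeet_idPl _ _ (rle_refl _)) => ->.
exact: rmeet_lel.
Qed.

(** Truncating [f] is cutting it at the height of the truncation of any larger
    element: on each order interval the truncation behaves as if it had a
    unit. *)
Lemma truncation_meet f h :
  val f <=r val h -> val (tau f) = rmeet (val f) (val (tau h)).
Proof.
move=> fh; rewrite -tauP; apply/esym/rmeet_idPl.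
exact: rle_trans' (truncation_le f) fh.
Qed.

(** The sum is used as an upper bound of two positive elements. *)
Definition addp f g : pos_cone E :=
  exist _ (val f + val g) (radd_ge0 (valP f) (valP g)).

Lemma addp_gel f g : val f <=r val (addp f g).
Proof. exact: rle_addr (valP g). Qed.

Lemma addp_ger f g : val g <=r val (addp f g).
Proof. exact: rle_addl (valP f). Qed.

End Truncation.

(** * Norm estimates *)

Section NormedRiesz.
Variables (R : realType) (E : normedRieszType R).
Implicit Types x y a b c d w : E.

Lemma rle_norm x y : 0 <=r x -> x <=r y -> `|x| <= `|y|.
Proof.
move=> x0 xy; apply: lattice_norm.
by rewrite !rabs_pos //; exact: rle_trans' x0 xy.
Qed.

Lemma rmeet_lip a c b : `|rmeet a b - rmeet c b| <= `|a - c|.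
Proof. exact/lattice_norm/rmeet_contract. Qed.

Lemma rmeet_lip2 a b c d :
  `|rmeet a b - rmeet c d| <= `|a - c| + `|b - d|.
Proof.
apply: le_trans (ler_distD (rmeet c b) _ _) _.
by rewrite lerD ?rmeet_lip // ![rmeet c _]rmeetC rmeet_lip.
Qed.

Lemma eq_norm_eps (K : R) x y :
  (forall e : R, 0 < e -> `|x - y| <= K * e) -> x = y.
Proof.
move=> h; apply/eqP; rewrite -subr_eq0 -normr_le0.
by apply: (@ler_scaled_eps _ K) => e e0; rewrite add0r h.
Qed.

(** The positive cone is norm closed, because taking negative parts is
    continuous. *)
Lemma rge0_closed x :
  (forall e : R, 0 < e -> exists2 y, 0 <=r y & `|y - x| <= e) -> 0 <=r x.
Proof.
move=> h; suff -> : 0 = rmeet 0 x by apply: rmeet_ler.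
apply: (@eq_norm_eps 1) => e e0; have [y y0 yx] := h e e0.
rewrite mul1r -{1}(rmeet_idPl _ _ y0) ![rmeet 0 _]rmeetC.
exact: le_trans (rmeet_lip _ _ _) yx.
Qed.

(** Below the common bound [f + g] the truncation is the meet with one fixed
    element. *)
Lemma truncation_lip (tau : pos_cone E -> pos_cone E) f g :
  is_truncation tau -> `|val (tau f) - val (tau g)| <= `|val f - val g|.
Proof.
move=> tauP; rewrite (truncation_meet tauP (addp_gel f g)).
by rewrite (truncation_meet tauP (addp_ger f g)) rmeet_lip.
Qed.

Lemma truncation_norm_le1 (tau : pos_cone E -> pos_cone E) :
  truncation_sup_norm tau = 1%:E -> forall f, `|val (tau f)| <= 1.
Proof.
by move=> h f; rewrite -lee_fin -h; apply: ereal_sup_ubound; exists f.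
Qed.

Lemma truncation_norm_near1 (tau : pos_cone E -> pos_cone E) (e : R) :
  truncation_sup_norm tau = 1%:E -> 0 < e ->
  exists f, 1 - e < `|val (tau f)|.
Proof.
move=> h e0; have : ((1 - e)%:E < truncation_sup_norm tau)%E.
  by rewrite h lte_fin ltrBlDr ltrDl.
by move=> /ereal_sup_gt[_ [f _ <-]]; rewrite lte_fin; exists f.
Qed.

(** The net of truncated elements is Cauchy.  It suffices to bound the
    increment [p = tau h - tau g] for [g = C f] below [h]: it is disjoint from
    an element [q] such that both lie below [tau h], and [q] has norm close
    to 1, which leaves no room for [p]. *)
Lemma truncation_gap (tau : pos_cone E -> pos_cone E) (e : R) :
  additive_on_disjoint E -> is_truncation tau ->
  truncation_sup_norm tau = 1%:E -> 0 < e ->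
  exists g, forall h, val g <=r val h ->
    `|val (tau h) - val (tau g)| <= e + e.
Proof.
move=> Eadd tauP tau1 e0.
have [f f1] := truncation_norm_near1 tau1 e0.
(* C must be at least 1 to have f <= C f, and C^-1 at most e for the error
   term. *)
pose C := Num.max 1 e^-1; pose x := C *: val f.
have C1 : 1 <= C by rewrite le_max lexx.
have eC : e^-1 <= C by rewrite le_max lexx orbT.
have Cgt0 : 0 < C := lt_le_trans ltr01 C1.
have C0 : 0 <= C := ltW Cgt0.
have Ce : C^-1 <= e by rewrite invf_ple.
have x0 : 0 <=r x := rscale_ge0 _ _ C0 (valP f).
exists (exist _ x x0) => h /= xh.
set w := val (tau h).
have w0 : 0 <=r w := valP (tau h).
have w1 : `|w| <= 1 := truncation_norm_le1 tau1 h.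
have fh : val f <=r val h := rle_trans' (rle_scale C1 (valP f)) xh.
rewrite (@truncation_meet _ _ _ tauP (exist _ x x0) h xh) -/w /= rmeetC.
have tfE := truncation_meet tauP fh; rewrite -/w in tfE.
set p := w - rmeet w x; pose d := x - rmeet w x; pose q := rmeet d w.
have p0 : 0 <=r p by rewrite rsub_ge0 rmeet_lel.
have d0 : 0 <=r d by rewrite rsub_ge0 rmeet_ler.
have q0 : 0 <=r q by apply: rmeet_ge0.
have pq0 : rmeet p q = 0.
  by rewrite rmeetA rmeetB_disjoint; apply/rmeet_idPl.
have pw : p <=r w by rewrite rleBDr rle_addr // rmeet_ge0.
have pqw : `|p| + `|q| <= 1.
  rewrite -Eadd //; apply: le_trans w1; apply: rle_norm; first exact: radd_ge0.
  exact: rdisjointD_le pq0 pw (rmeet_ler _ _).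
(* As tau f <= w and q is the meet of d and w, it suffices to bound tau f by
   d + C^-1 w; indeed f is C^-1 d plus C^-1 times the meet of w and x. *)
have tfq : val (tau f) <=r q + C^-1 *: w.
  have Ci0 : 0 <= C^-1 by rewrite invr_ge0.
  rewrite tfE rmeetDr rmeetP; apply/andP; split; last first.
    by apply: rle_trans' (rmeet_ler _ _) _; apply/rle_addr/rscale_ge0.
  apply: rle_trans' (rmeet_lel _ _) _.
  have -> : val f = C^-1 *: d + C^-1 *: rmeet w x.
    by rewrite -scalerDr subrK scalerA mulVf ?scale1r // gt_eqF.
  apply: rleD; last by apply: rle_scale_mono; rewrite ?rmeet_lel.
  rewrite -{2}(scale1r d) -(@mulfV _ C) ?gt_eqF // -scalerA.
  by apply: rle_scale => //; apply: rscale_ge0.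
have := le_trans (rle_norm (valP (tau f)) tfq) (ler_normD _ _).
rewrite normrZ ger0_norm ?invr_ge0 //.
have : C^-1 * `|w| <= e by rewrite -[e]mulr1 ler_pM // invr_ge0.
lra.
Qed.

End NormedRiesz.

(** * Banach lattices *)

Section Banach.
Variables (R : realType) (F : banachLatticeType R).

(** Completeness, for elements given with an error bound: [P e y] says that [y]
    approximates an object which is not yet known within [e], so that two
    approximations differ by at most the sum of their errors.  The object is
    then the limit of approximations with errors tending to 0. *)
Lemma approx_limit (P : R -> F -> Prop) :
  (forall e : R, 0 < e -> exists y, P e y) ->
  (forall e y d z, P e y -> P d z -> `|y - z| <= e + d) ->
  exists l, forall e y, P e y -> `|y - l| <= e.
Proof.
move=> Pex Pcauchy.
pose s (n : nat) : R := n.+1%:R^-1.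
have s_small (e : R) : 0 < e -> exists N, forall n, (N <= n)%N -> s n < e.
  by move=> e0; have [N _ HN] := near_infty_natSinv_lt (PosNum e0); exists N.
have /choice[u Pu] : forall n, exists y, P (s n) y.
  by move=> n; apply: Pex; rewrite invr_gt0.
have ucvg : cvgn u.
  apply/cauchy_cvgP/cauchy_exP => e e0.
  have [|N HN] := s_small (e / 2); first by rewrite divr_gt0.
  exists (u N); exists N => // n Nn /=.
  rewrite -ball_normE /=; apply: le_lt_trans (Pcauchy _ _ _ _ (Pu N) (Pu n)) _.
  by rewrite [ltRHS]splitr ltrD //; apply: HN => /=.
exists (limn u) => e y Py; apply: (@ler_scaled_eps _ 2) => d d0.
have [N /(_ _ (leq_maxl _ _)) HN] := s_small d d0.
move/cvgrPdist_le/(_ _ d0): ucvg => [M _ /(_ _ (leq_maxr N _)) /= un].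
rewrite distrC in un; have yn := Pcauchy _ _ _ _ Py (Pu (maxn N M)).
apply: le_trans (ler_distD (u (maxn N M)) _ _) (le_trans (lerD yn un) _).
by have := HN M; lra.
Qed.

(** The unit is the limit of the truncations of ever larger elements. *)
Lemma truncation_unital (tau : pos_cone F -> pos_cone F) :
  additive_on_disjoint F -> is_truncation tau ->
  truncation_sup_norm tau = 1%:E -> unital tau.
Proof.
move=> Fadd tauP tau1.
(* tau g approximates the unit within e once the net varies by at most e above
   g. *)
pose P e y := exists2 g, y = val (tau g) &
  forall h, val g <=r val h -> `|val (tau h) - val (tau g)| <= e.
have Pex (e : R) : 0 < e -> exists y : F, P e y.
  move=> e0; have [|g Hg] := @truncation_gap _ _ tau (e / 2) Fadd tauP tau1.
    by rewrite divr_gt0.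
  by exists (val (tau g)), g => // h /Hg; rewrite -splitr.
have Pcauchy e y d z : P e y -> P d z -> `|y - z| <= e + d.
  move=> [g -> Hg] [k -> Hk].
  apply: le_trans (ler_distD (val (tau (addp g k))) _ _) _; rewrite lerD //.
    by rewrite distrC Hg // addp_gel.
  by rewrite Hk // addp_ger.
have [l Hl] := approx_limit Pex Pcauchy.
have l0 : 0 <=r l.
  apply: rge0_closed => e e0; have [y Py] := Pex e e0.
  by exists y; [case: Py => g -> _; apply: valP|exact: Hl].
exists (exist _ l l0) => f /=; apply: (@eq_norm_eps _ _ 2) => e e0.
have [_ [g _ Hg]] := Pex e e0.
have gl : `|val (tau g) - l| <= e by apply: Hl; exists g.
rewrite (truncation_meet tauP (addp_gel f g)) rmeetC.
apply: le_trans (rmeet_lip _ _ _) _.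
apply: le_trans (ler_distD (val (tau g)) _ _) _.
have := Hg _ (addp_ger f g); lra.
Qed.

End Banach.

(** * Norm completions *)

Section Completion.
Variables (R : realType) (E : normedRieszType R) (F : banachLatticeType R).
Variable iota : {linear E -> F}.
Hypothesis HF : is_norm_completion iota.
Implicit Types (x y : E) (f g : pos_cone E).

Lemma completion_dist x y : `|iota x - iota y| = `|x - y|.
Proof. by rewrite -linearB (completion_norm HF). Qed.

Lemma completion_inj x y : iota x = iota y -> x = y.
Proof.
move=> xy; apply: (@eq_norm_eps _ _ 1) => e e0.
by rewrite -completion_dist xy subrr normr0 mul1r ltW.
Qed.

Lemma completion_ge0 x : (0 <=r iota x) = (0 <=r x).
Proof.
apply/rmeet_idPl/rmeet_idPl => h; last first.
  by rewrite -(linear0 iota) -(completion_meet HF) h.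
by apply: completion_inj; rewrite (completion_meet HF) linear0.
Qed.

Definition pos_iota f : pos_cone F :=
  exist _ (iota (val f)) (etrans (completion_ge0 (val f)) (valP f)).

(** If [iota x] is close to [z], then so is the image of the positive part of
    [x], since [z] is its own positive part. *)
Lemma pos_dense (z : pos_cone F) (e : R) :
  0 < e -> exists f, `|val z - iota (val f)| <= e.
Proof.
move=> e0.
have ne : ball (val z) e !=set0 by exists (val z); apply: ballxx.
have [y [+ [x _ xy]]] := completion_dense HF ne (ball_open (val z) e).
rewrite -{}xy -ball_normE /= => zx.
have xp : 0 <=r - rmeet (- x) 0.
  by rewrite -sub0r rsub_ge0 rmeet_ler.
exists (exist _ (- rmeet (- x) 0) xp) => /=.
have zE : val z = - rmeet (- val z) 0.
  rewrite (rmeet_idPl _ _ _) ?opprK //.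
  by rewrite -rsub_ge0 sub0r opprK; apply: valP.
rewrite {1}zE linearN (completion_meet HF) linear0 -opprD normrN.
apply: le_trans (rmeet_lip _ _ _) _.
by rewrite linearN -opprD normrN; exact: ltW.
Qed.

(** Approximants of two disjoint elements become disjoint after their meet,
    which is small, has been subtracted from both. *)
Lemma completion_AL : additive_on_disjoint E -> is_AL_space F.
Proof.
move=> Eadd x y x0 y0 xy0.
(* Each approximant is within 3 e: e from density, 2 e from the meet that is
   subtracted.  Both sides of the equation are then off by at most 6 e. *)
suff H (e : R) : 0 < e -> `| `|x + y| - (`|x| + `|y|) | <= 12 * e.
  apply/eqP; rewrite -subr_eq0 -normr_le0.
  by apply: (@ler_scaled_eps _ 12) => e e0; rewrite add0r H.
move=> e0.
have [a Ha] := pos_dense (exist _ x x0) e0.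
have [b Hb] := pos_dense (exist _ y y0) e0.
rewrite /= in Ha Hb.
pose m := rmeet (val a) (val b).
have mE : `|iota m| <= 2 * e.
  rewrite (completion_meet HF) -normrN -sub0r -xy0.
  apply: le_trans (rmeet_lip2 _ _ _ _) _; lra.
have := Eadd (val a - m) (val b - m).
rewrite !rsub_ge0 rmeet_lel rmeet_ler rmeetB_disjoint => /(_ isT isT erefl).
rewrite -!(completion_norm HF) linearD !linearB.
set a' := iota (val a) - _; set b' := iota (val b) - _ => ab.
have Ha' : `|x - a'| <= 3 * e.
  rewrite /a' opprB addrCA; apply: le_trans (ler_normD _ _) _; lra.
have Hb' : `|y - b'| <= 3 * e.
  rewrite /b' opprB addrCA; apply: le_trans (ler_normD _ _) _; lra.
have := lerB_dist x a'; have := lerB_dist a' x.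
have := lerB_dist y b'; have := lerB_dist b' y.
have := lerB_dist (x + y) (a' + b'); have := lerB_dist (a' + b') (x + y).
have : `|x + y - (a' + b')| <= 6 * e.
  rewrite opprD addrACA; apply: le_trans (ler_normD _ _) _; lra.
rewrite ![`|a' - x|]distrC ![`|b' - y|]distrC ![`|a' + b' - _|]distrC => *.
rewrite ler_norml; lra.
Qed.

Section Extension.
Variable tau : pos_cone E -> pos_cone E.
Hypothesis tauP : is_truncation tau.

(** [y] is the limit of [tau] along the positive elements of [E] that approach
    [z], with the rate of a 1-Lipschitz map.  Asking for this rate makes the
    value unique and easy to recognise for any 1-Lipschitz extension. *)
Definition extension_value (z : pos_cone F) (y : F) : Prop :=
  forall g, `|iota (val (tau g)) - y| <= `|val z - iota (val g)|.

Lemma extension_value_exists z :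
  exists y : pos_cone F, extension_value z (val y).
Proof.
pose P (e : R) (y : F) :=
  exists2 g, y = iota (val (tau g)) & `|val z - iota (val g)| <= e.
have Pex (e : R) : 0 < e -> exists y : F, P e y.
  by move=> /(pos_dense z)[g zg]; exists (iota (val (tau g))), g.
have Pcauchy e (y : F) d (w : F) : P e y -> P d w -> `|y - w| <= e + d.
  move=> [g -> Hg] [k -> Hk]; rewrite completion_dist.
  apply: le_trans (truncation_lip _ _ tauP) _.
  rewrite -completion_dist.
  by apply: le_trans (ler_distD (val z) _ _) _; rewrite lerD // distrC.
have [l Hl] := approx_limit Pex Pcauchy.
have l0 : 0 <=r l.
  apply: rge0_closed => e e0; have [y Py] := Pex e e0.
  exists y; last exact: Hl.
  by case: Py => g -> _; rewrite completion_ge0; apply: valP.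
by exists (exist _ l l0) => g /=; apply: Hl; exists g.
Qed.

Lemma extension_value_unique z (y w : F) :
  extension_value z y -> extension_value z w -> y = w.
Proof.
move=> Hy Hw; apply: (@eq_norm_eps _ _ 2) => e /(pos_dense z)[g zg].
apply: le_trans (ler_distD (iota (val (tau g))) _ _) _.
rewrite distrC; have := Hy g; have := Hw g; lra.
Qed.

(** Truncations of [F] are 1-Lipschitz, so they have no choice but to take the
    values given by the limits. *)
Lemma extends_value sigma z :
  is_truncation sigma -> extends_truncation iota tau sigma ->
  extension_value z (val (sigma z)).
Proof.
move=> sP sE g; rewrite -(sE g (pos_iota g) erefl) distrC.
exact: (@truncation_lip _ _ sigma z (pos_iota g)).
Qed.

Variable taubar : pos_cone F -> pos_cone F.
Hypothesis taubarP : forall z, extension_value z (val (taubar z)).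

Lemma extension_extends : extends_truncation iota tau taubar.
Proof.
move=> f z zf; apply: (@extension_value_unique z) => // g.
by rewrite zf !completion_dist distrC truncation_lip.
Qed.

Lemma extension_truncation : is_truncation taubar.
Proof.
move=> z w; apply: (@eq_norm_eps _ _ 4) => e e0.
have [f zf] := pos_dense z e0; have [g wg] := pos_dense w e0.
have := rmeet_lip2 (iota (val (tau f))) (iota (val g)) (val (taubar z)) (val w).
have := rmeet_lip2 (iota (val f)) (iota (val (tau g))) (val z) (val (taubar w)).
rewrite -!(completion_meet HF) tauP.
set m := iota _ => h1 h2.
apply: le_trans (ler_distD m _ _) _; rewrite [X in X + _]distrC.
move: h1 h2; rewrite [`|_ - val z|]distrC [`|_ - val w|]distrC.
have := taubarP z f; have := taubarP w g; lra.
Qed.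

Lemma extension_sup_norm :
  truncation_sup_norm tau = 1%:E -> truncation_sup_norm taubar = 1%:E.
Proof.
move=> tau1; apply/eqP; rewrite eq_le; apply/andP; split.
  apply: ge_ereal_sup => _ [z _ <-]; rewrite lee_fin.
  apply: (@ler_scaled_eps _ 1) => e /(pos_dense z)[g zg].
  have := taubarP z g; have := truncation_norm_le1 tau1 g.
  rewrite -(completion_norm HF) distrC.
  have := lerB_dist (val (taubar z)) (iota (val (tau g))); lra.
rewrite -tau1; apply: ge_ereal_sup => _ [f _ <-].
apply: ereal_sup_ubound; exists (pos_iota f) => //.
by rewrite (extension_extends (f := f)) // (completion_norm HF).
Qed.

Lemma extension_unit_notin u :
  ~ unital tau -> is_truncation_unit taubar u -> ~ range iota (val u).
Proof.
move=> nu uP [e _ eu]; apply: nu.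
have e0 : 0 <=r e by rewrite -completion_ge0 eu; apply: valP.
exists (exist _ e e0) => f; apply: completion_inj.
rewrite (completion_meet HF) /= eu.
by rewrite -(extension_extends (g := pos_iota f)) // uP.
Qed.

End Extension.
End Completion.

Theorem theorem3p7 (R : realType) (E : normedRieszType R)
    (tau : pos_cone E -> pos_cone E)
    (Htau : is_truncated_normed_riesz tau)
    (F : banachLatticeType R) (iota : {linear E -> F})
    (HF : is_norm_completion iota) :
  exists taubar : pos_cone F -> pos_cone F,
    [/\ is_truncation taubar,
        extends_truncation iota tau taubar,
        truncation_sup_norm taubar = 1%:E,
        (forall sigma : pos_cone F -> pos_cone F,
            is_truncation sigma -> extends_truncation iota tau sigma ->
            sigma = taubar)
      & (~ unital tau -> additive_on_disjoint E ->
         [/\ is_AL_space F,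
             unital taubar
           & forall u : pos_cone F, is_truncation_unit taubar u ->
               ~ range iota (val u)])].
Proof.
have [tauP _ tau1] := Htau.
have /choice[taubar taubarP] := extension_value_exists HF tauP.
have tbP := extension_truncation HF tauP taubarP.
have tb1 := extension_sup_norm HF tauP taubarP tau1.
exists taubar; split=> //; first by move=> f z; apply: extension_extends.
  move=> sigma sP sE; apply/funext => z; apply: val_inj.
  exact: (extension_value_unique HF (extends_value HF z sP sE) (taubarP z)).
move=> nu Eadd; have FAL := completion_AL HF Eadd.
split=> // [|u]; first exact: truncation_unital.
exact: (extension_unit_notin HF tauP taubarP nu).
Qed.
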